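(* If a connected Jacobi manifold $(M,\pi_M,E_M)$ admits a separable contact resolution, then it is contact on a dense open subset. In particular, it is of odd dimension.
   Context: Manifolds are smooth or real analytic, and assumed separable (second countable). A Jacobi structure on a manifold $M$ is a pair $(\pi_M,E_M)$ of a bivector field and a vector field such that $[\pi_M,\pi_M]=2E_M\wedge\pi_M$ and $[E_M,\pi_M]=0$, with the sign of the Schouten bracket normalized so that this is equivalent to the Jacobi identity for $\{f,g\}=\pi_M(df,dg)+fE_M[g]-gE_M[f]$. A contact manifold of dimension $2n+1$ is regarded as a manifold $\Sigma$ with a Jacobi structure $(\Pi_\Sigma,E_\Sigma)$ such that $E_\Sigma\wedge\Pi_\Sigma^n$ vanishes at no point; accordingly a Jacobi structure is contact on an open subset $U$ if $\dim M=2n+1$ and $E_M\wedge\pi_M^n$ vanishes at no point of $U$. A Jacobi morphism $\varphi:\Sigma\to M$ is a map projecting $\Pi_\Sigma$ and $E_\Sigma$ onto $\pi_M$ and $E_M$, i.e. $\wedge^2T_\sigma\varphi(\Pi_\Sigma|_\sigma)=\pi_M|_{\varphi(\sigma)}$ and $T_\sigma\varphi(E_\Sigma|_\sigma)=E_M|_{\varphi(\sigma)}$ for all $\sigma\in\Sigma$. A contact resolution of a Jacobi manifold $M$ is a contact manifold $\Sigma$ of the same dimension together with a surjective Jacobi morphism $\varphi:\Sigma\to M$; it is separable if $\Sigma$ is separable (second countable). *)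

(* Defs.v *)
From HB Require Import structures.
From mathcomp Require Import all_boot all_order all_algebra all_fingroup.
From mathcomp Require Import all_classical all_reals all_analysis.

Set Implicit Arguments.
Unset Strict Implicit.
Unset Printing Implicit Defensive.

Import Order.TTheory GRing.Theory Num.Theory.
Import numFieldNormedType.Exports.

Local Open Scope classical_set_scope.
Local Open Scope ring_scope.

Inductive regularity := Smooth | Analytic.

Section Euclidean.
Variables (R : realType) (d : nat).
Implicit Types (f : 'rV[R]_d -> R) (A : set 'rV[R]_d) (y h : 'rV[R]_d).

Definition partial (l : 'I_d) f : 'rV[R]_d -> R :=
  fun y => 'D_(delta_mx 0 l) f y.

(* The value of f outside of the open set A is irrelevant. *)
Definition smooth_on A f :=
  forall (s : seq 'I_d) y, A y -> differentiable (foldr partial f s) y.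

(* A multi-index of degree k has entries at most k, hence the finite type. *)
Definition homog_part (c : ('I_d -> nat) -> R) (k : nat) h : R :=
  \sum_(a : {ffun 'I_d -> 'I_k.+1} | (\sum_i a i == k)%N)
     c (fun i => a i : nat) * \prod_i h 0 i ^+ a i.

Definition abs_homog_part (c : ('I_d -> nat) -> R) (k : nat) h : R :=
  \sum_(a : {ffun 'I_d -> 'I_k.+1} | (\sum_i a i == k)%N)
     `|c (fun i => a i : nat) * \prod_i h 0 i ^+ a i|.

(* f is the sum of an absolutely convergent multivariate power series
   around y. *)
Definition power_series_at f y :=
  exists c : ('I_d -> nat) -> R,
  \forall z \near y,
    cvgn (series (fun k => abs_homog_part c k (z - y))) /\
    series (fun k => homog_part c k (z - y)) @ \oo --> f z.

Definition regular_on (r : regularity) A f :=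
  smooth_on A f /\
  match r with
  | Smooth => True
  | Analytic => forall y, A y -> power_series_at f y
  end.

Definition regular_map_on (r : regularity) A (e : nat)
    (F : 'rV[R]_d -> 'rV[R]_e) :=
  forall j, regular_on r A (fun y => F y 0 j).

(* Contravariant k-tensors on R^d, given by their components; a k-vector is an
   alternating one.  The normalization of the wedge product is such that
   X /\ Y = X (x) Y - Y (x) X for vectors. *)
Definition tensor (k : nat) := ('I_k -> 'I_d) -> R.

Definition wedge (k l : nat) (S : tensor k) (T : tensor l) : tensor (k + l) :=
  fun t => (k`! * l`!)%:R^-1 *
    \sum_(s : 'S_(k + l)) (-1) ^+ s *
      S (fun i => t (s (lshift l i))) * T (fun j => t (s (rshift k j))).

Fixpoint wedge_pow (T : tensor 2) (n : nat) : tensor (n * 2) :=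
  match n with
  | 0%N => fun=> 1
  | m.+1 => wedge T (@wedge_pow T m)
  end.

Definition tensor_of_vector (X : 'rV[R]_d) : tensor 1 := fun t => X 0 (t ord0).

Definition tensor_of_bivector (P : 'M[R]_d) : tensor 2 :=
  fun t => P (t ord0) (t ord_max).

End Euclidean.
Arguments wedge_pow {R d} T n.

Record chart (R : realType) (T : topologicalType) (d : nat) := Chart {
  dom : set T;
  coord :> T -> 'rV[R]_d;
  param : 'rV[R]_d -> T;
  open_dom : open dom;
  open_img : open (coord @` dom);
  coordK : {in dom, cancel coord param};
  coord_cont : {in dom, continuous coord};
  param_cont : {in coord @` dom, continuous param}
}.

(* Second countability is kept separate, see [second_countable]. *)
Record manifold (R : realType) (r : regularity) (d : nat) := Manifold {
  carrier :> topologicalType;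
  carrier_hausdorff : hausdorff_space carrier;
  atlas : set (chart R carrier d);
  atlas_cover : forall p, exists2 c, atlas c & dom c p;
  atlas_compat : forall c c', atlas c -> atlas c' ->
    regular_map_on r (c @` (dom c `&` dom c')) (c' \o param c)
}.

Section Tensors.
Variables (R : realType) (r : regularity) (d : nat) (M : manifold R r d).

(* Vector and bivector fields are given by their components in each chart, with
   the usual change of coordinates.  Tangent vectors are rows and
   'J f y i j = d f_j / d y_i, so that the tangent map of f is v |-> v *m 'J f y
   and the one induced on bivectors is P |-> ('J f y)^T *m P *m 'J f y.
   A bivector P is identified with the skew matrix of the P(dx_i, dx_j). *)

Record vector_field := VectorField {
  vf :> chart R M d -> M -> 'rV[R]_d;
  vf_change : forall c c' p, atlas c -> atlas c' -> dom c p -> dom c' p ->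
    vf c' p = vf c p *m 'J (c' \o param c) (c p);
  vf_regular : forall c, atlas c ->
    forall j, regular_on r (c @` dom c) (fun y => vf c (param c y) 0 j)
}.

Record bivector_field := BivectorField {
  bf :> chart R M d -> M -> 'M[R]_d;
  bf_skew : forall c p, atlas c -> dom c p -> (bf c p)^T = - bf c p;
  bf_change : forall c c' p, atlas c -> atlas c' -> dom c p -> dom c' p ->
    bf c' p =
    ('J (c' \o param c) (c p))^T *m bf c p *m 'J (c' \o param c) (c p);
  bf_regular : forall c, atlas c ->
    forall i j, regular_on r (c @` dom c) (fun y => bf c (param c y) i j)
}.

Definition dvf (X : vector_field) (c : chart R M d) (p : M) (l i : 'I_d) : R :=
  partial l (fun y => X c (param c y) 0 i) (c p).

Definition dbf (P : bivector_field) (c : chart R M d) (p : M)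
    (l i j : 'I_d) : R :=
  partial l (fun y => P c (param c y) i j) (c p).

(* The (i, j, k) component of [P, P].  Up to the factor 2, it is the Jacobiator
   {{x_i, x_j}, x_k} + cyclic of {f, g} = P(df, dg).  For the bracket
   {f, g} = P(df, dg) + f E(g) - g E(f), the terms of the Jacobiator involving
   only first derivatives of all three functions are those of
   [P, P] / 2 - E /\ P, which fixes the sign. *)
Definition schouten_bb (P : bivector_field) c p (i j k : 'I_d) : R :=
  2 * \sum_l (P c p l k * dbf P c p l i j +
              P c p l i * dbf P c p l j k +
              P c p l j * dbf P c p l k i).

(* The (i, j) component of [X, P], the Lie derivative of P along X. *)
Definition schouten_vb (X : vector_field) (P : bivector_field) c p
    (i j : 'I_d) : R :=
  \sum_l (X c p 0 l * dbf P c p l i j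
          - P c p l j * dvf X c p l i
          - P c p i l * dvf X c p l j).

Record jacobi_structure := JacobiStructure {
  jpi : bivector_field;
  jE : vector_field;
  jacobi_pi_pi : forall c p, atlas c -> dom c p -> forall i j k,
    schouten_bb jpi c p i j k =
    2 * wedge (tensor_of_vector (jE c p)) (tensor_of_bivector (jpi c p))
          (tnth [tuple i; j; k]);
  jacobi_E_pi : forall c p, atlas c -> dom c p -> forall i j,
    schouten_vb jE jpi c p i j = 0
}.

(* The components of E /\ pi^n at p in the chart c. *)
Definition contact_tensor (J : jacobi_structure) (n : nat) c p :
    tensor R d (1 + n * 2) :=
  wedge (tensor_of_vector (jE J c p))
        (wedge_pow (tensor_of_bivector (jpi J c p)) n).

Arguments contact_tensor : clear implicits.

Definition contact_on (J : jacobi_structure) (U : set M) :=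
  exists2 n : nat, d = (2 * n + 1)%N &
    forall c p, atlas c -> dom c p -> U p ->
      exists t, contact_tensor J n c p t != 0.

End Tensors.

Section Morphisms.
Variables (R : realType) (r : regularity).

Definition regular_map (d e : nat) (M : manifold R r d) (N : manifold R r e)
    (phi : M -> N) :=
  continuous phi /\
  forall (c : chart R M d) (c' : chart R N e), atlas c -> atlas c' ->
    regular_map_on r (c @` (dom c `&` phi @^-1` dom c'))
                     (c' \o phi \o param c).

Definition jacobi_morphism (d e : nat) (M : manifold R r d)
    (N : manifold R r e) (JM : jacobi_structure M) (JN : jacobi_structure N)
    (phi : M -> N) :=
  regular_map phi /\
  forall (c : chart R M d) (c' : chart R N e) (p : M),
    atlas c -> atlas c' -> dom c p -> dom c' (phi p) ->
    let T := 'J (c' \o phi \o param c) (c p) in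
    T^T *m jpi JM c p *m T = jpi JN c' (phi p) /\
    jE JM c p *m T = jE JN c' (phi p).

Record contact_resolution (d : nat) (M : manifold R r d)
    (J : jacobi_structure M) := ContactResolution {
  res_manifold : manifold R r d;
  res_jacobi : jacobi_structure res_manifold;
  res_contact : contact_on res_jacobi [set: res_manifold];
  res_map : res_manifold -> M;
  res_morphism : jacobi_morphism res_jacobi J res_map;
  res_surj : forall q, exists p, res_map p = q
}.

Definition separable_resolution (d : nat) (M : manifold R r d)
    (J : jacobi_structure M) (S : contact_resolution J) :=
  @second_countable (res_manifold S).

End Morphisms.

(* Main.v *)
From HB Require Import structures.
From mathcomp Require Import all_boot all_order all_algebra all_fingroup.
From mathcomp Require Import all_classical all_reals all_analysis.
From mathcomp Require Import ring lra.
Require Import Defs.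

(** Let [phi : S -> M] be the resolution, with [dim S = dim M = 2n + 1], and
    let [U] be the set of points of [M] at which [E /\ pi^n] does not vanish.

    The components of [E /\ pi^n] are polynomials in those of [E] and [pi], so
    they are continuous and [U] is open.  Forming [E /\ pi^n] commutes with the
    action of a linear map on tensors ([wedge_push], [contact_form_push_neq0]).
    Applied to the Jacobian of a change of coordinates, this makes the choice
    of the chart immaterial; applied to the inverse of the tangent map of [phi]
    at a point [p] where that map is invertible, it shows that [phi p] is in
    [U], because the structure of [S] is contact at [p].

    It remains to see that every nonempty open subset [V] of [M] contains the
    image of a point where the tangent map is invertible: this is Sard's theorem
    in equal dimensions, [regular_point_exists].  Otherwise all points of
    [phi @^-1` V] are critical, and as [S] is second countable and [phi] is
    surjective, [V] is covered by countably many images of closed coordinate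
    cubes.  These images are compact, and have empty interior by
    [critical_image_no_cube], which contradicts Baire's theorem.

    In [critical_image_no_cube], a map [f] is differentiable with singular
    Jacobian everywhere on a cube.  The size of a set is measured by
    [content_le], the total volume of a finite cover by cubes.  Near a point
    [x], [f] maps a cube of radius [r] into the [o(r)]-neighbourhood of a
    hyperplane, which has content [o(r ^ d)] ([content_slab],
    [content_image_critical_at]).  Repeated bisection, in the style of Cousin's
    lemma, turns this local bound into the bound [e * r ^ d] for the image of
    the whole cube and every [e > 0] ([content_image_critical]).  On the other
    hand, counting lattice points shows that a cube has positive content
    ([content_cube]). *)

Set Implicit Arguments.
Unset Strict Implicit.
Unset Printing Implicit Defensive.

Import Order.TTheory GRing.Theory Num.Theory.
Import numFieldNormedType.Exports.

Local Open Scope classical_set_scope.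
Local Open Scope ring_scope.

(** * Content of sets covered by finitely many cubes *)

Section Content.
Variables (R : realType) (d : nat).
Implicit Types (a c x y z : 'rV[R]_d) (S : set 'rV[R]_d).

Definition cube a (r : R) : set 'rV[R]_d :=
  [set y | forall i, `|y 0 i - a 0 i| <= r].

(** The volume of [cube a r] is [(2 * r) ^ d], so [al] bounds the total volume
    of a finite cover up to the factor [2 ^ d].  Cubes of different sizes are
    allowed because bisection stops at a scale that depends on the point. *)
Definition content_le S (al : R) :=
  exists l : seq ('rV[R]_d * R),
    [/\ forall b, b \in l -> 0 < b.2,
        forall x, S x -> exists2 b, b \in l & cube b.1 b.2 x &
        \sum_(b <- l) b.2 ^+ d <= al].

Lemma content_le_bigcup (I : finType) S (F : I -> set 'rV[R]_d) (al : I -> R) :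
  S `<=` \bigcup_i F i -> (forall i, content_le (F i) (al i)) ->
  content_le S (\sum_i al i).
Proof.
move=> SF /choice[l Hl]; exists (flatten [seq l i | i <- index_enum I]); split.
- move=> b /flattenP[_ /mapP[i _ ->] bi].
  by case: (Hl i) => + _ _; apply.
- move=> x /SF[i _ Fx]; case: (Hl i) => _ /(_ _ Fx)[b bl bx] _.
  by exists b => //; apply/flattenP; exists (l i) => //; apply: map_f.
- rewrite big_flatten big_map; apply: ler_sum => i _.
  by case: (Hl i).
Qed.

Lemma card_separated (m q : nat) (A : {set 'I_m}) :
  (forall i j, i \in A -> j \in A -> (j <= i + q)%N) -> (#|A| <= q.+1)%N.
Proof.
move=> AQ; have [->|[i0 i0A]] := set_0Vmem A; first by rewrite cards0.
pose i1 := [arg min_(i < i0 in A) (i : nat)].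
have [i1A i1min] : i1 \in A /\ forall j, j \in A -> (i1 <= j)%N.
  by rewrite /i1; case: arg_minnP.
rewrite cardE -(size_map val) -(size_iota i1 q.+1); apply: uniq_leq_size.
  by rewrite map_inj_uniq ?enum_uniq//; exact: val_inj.
move=> _ /mapP[j + ->]; rewrite mem_enum mem_iota => jA.
by rewrite addnS ltnS AQ// i1min.
Qed.

(** An interval of length [2 * rho] contains at most [2 * rho / h + 1] points
    of a lattice of step [h], and [1 <= rho / h]. *)
Lemma card_grid_interval (m : nat) (a0 b0 h rho : R) : 0 < h -> h <= rho ->
  #|[set k : 'I_m | `|a0 + h * k%:R - b0| <= rho]%SET|%:R <= 3 * rho / h.
Proof.
move=> h0 hrho; set A := finset _.
have r0 : 0 < rho by apply: lt_le_trans hrho.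
have q0 : 0 <= 2 * rho / h by rewrite divr_ge0 ?mulr_ge0 ?ltW.
have : (#|A| <= (Num.truncn (2 * rho / h)).+1)%N.
  apply: card_separated => i j; rewrite !inE => Ai Aj.
  rewrite leqNgt; apply/negP => jij.
  have ijn : (i + Num.truncn (2 * rho / h)).+1%:R <= j%:R :> R by rewrite ler_nat.
  have tr := truncnS_gt (2 * rho / h).
  move: ijn; rewrite -addnS natrD => ijn.
  have : 2 * rho / h < j%:R - i%:R by lra.
  rewrite ltr_pdivrMr// => H.
  move: Ai Aj; rewrite !ler_norml => /andP[? ?] /andP[? ?]; nra.
rewrite -(ler_nat R) => /le_trans; apply.
rewrite -natr1.
have : (Num.truncn (2 * rho / h))%:R <= 2 * rho / h :> R by rewrite truncn_le.
have : 1 <= rho / h by rewrite ler_pdivlMr// mul1r.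
by rewrite -!mulrA; lra.
Qed.

(** Gives a lattice whose step [s / m] is at most the radius of each of the
    finitely many cubes of a cover. *)
Lemma grid_fineness (s : R) (l : seq ('rV[R]_d * R)) :
  (forall b, b \in l -> 0 < b.2) ->
  exists2 m : nat, (0 < m)%N & forall b, b \in l -> s <= m%:R * b.2.
Proof.
elim: l => [|b l IH] bl; first by exists 1%N.
have [|m m0 ml] := IH; first by move=> b' b'l; apply: bl; rewrite inE b'l orbT.
have b0 : 0 < b.2 by apply: bl; rewrite mem_head.
exists (m + (Num.truncn (s / b.2)).+1)%N; first by rewrite addn_gt0 m0.
move=> b'; rewrite inE natrD mulrDl => /predU1P[->|b'l].
  apply: (@le_trans _ _ ((Num.truncn (s / b.2)).+1%:R * b.2)).
    by rewrite -ler_pdivrMr// ltW// truncnS_gt.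
  by rewrite lerDr mulr_ge0// ltW.
rewrite (le_trans (ml _ b'l))// lerDl mulr_ge0// ltW// bl//.
by rewrite inE b'l orbT.
Qed.

(** For [m] large, the cube contains [m ^ d] points of a lattice of step
    [h = s / m], while a cube of radius [rho] of the cover contains at most
    [(3 * rho / h) ^ d] of them. *)
Lemma content_cube a s al : 0 < s -> content_le (cube a s) al ->
  (s / 3) ^+ d <= al.
Proof.
move=> s0 [l [l0 cov le_al]].
have [m m0 ml] := grid_fineness s l0.
have mR : 0 < m%:R :> R by rewrite ltr0n.
pose h := s / m%:R; have h0 : 0 < h by rewrite divr_gt0.
have hl b : b \in l -> h <= b.2.
  by move=> bl; rewrite ler_pdivrMr// mulrC ml.
(* The lattice points above the centre in each coordinate suffice. *)
pose p (k : {ffun 'I_d -> 'I_m}) : 'rV[R]_d := \row_i (a 0 i + h * (k i)%:R).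
pose inc (b : 'rV[R]_d * R) (k : {ffun 'I_d -> 'I_m}) :=
  [forall i, `|a 0 i + h * (k i)%:R - b.1 0 i| <= b.2].
have pcov k : (1 <= \sum_(b <- l) (inc b k : nat))%N.
  have [|b bl bk] := cov (p k).
    move=> i; rewrite mxE addrC addKr normrM (gtr0_norm h0) normr_nat.
    rewrite /h -mulrA ler_piMr ?(ltW s0)// mulrC ler_pdivrMr// mul1r ler_nat.
    exact: ltnW.
  rewrite (big_rem b bl)/= (_ : inc b k = true)//.
  by apply/forallP => i; have := bk i; rewrite mxE.
have count b : b \in l ->
    (\sum_(k : {ffun 'I_d -> 'I_m}) (inc b k : nat))%:R
      <= (3 * b.2 / h) ^+ d :> R.
  move=> bl; rewrite -big_mkcond sum1_card.
  pose A i := [set k : 'I_m | `|a 0 i + h * k%:R - b.1 0 i| <= b.2]%SET.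
  have -> : #|inc b| = #|family A|.
    apply: eq_card => k; rewrite unfold_in; apply/forallP/familyP => /= H i;
      by have := H i; rewrite inE.
  rewrite card_family foldrE big_map big_enum/= natr_prod.
  have -> : (3 * b.2 / h) ^+ d = \prod_(i < d) (3 * b.2 / h).
    by rewrite prodr_const card_ord.
  apply: ler_prod => i _.
  by rewrite ler0n/= card_grid_interval// hl.
have mdle : (m ^ d)%:R <= \sum_(b <- l) (3 * b.2 / h) ^+ d :> R.
  apply: (@le_trans _ _ (\sum_(b <- l)
      (\sum_(k : {ffun 'I_d -> 'I_m}) (inc b k : nat))%N%:R)); last first.
    rewrite big_seq [leRHS]big_seq; apply: ler_sum => b bl; exact: count.
  rewrite -natr_sum ler_nat exchange_big/=.
  have -> : (m ^ d)%N = #|{ffun 'I_d -> 'I_m}| by rewrite card_ffun !card_ord.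
  rewrite -sum1_card.
  by apply: leq_sum => k _; exact: pcov.
have E : \sum_(b <- l) (3 * b.2 / h) ^+ d =
    (3 / h) ^+ d * \sum_(b <- l) b.2 ^+ d.
  rewrite mulr_sumr; apply: eq_bigr => b _.
  by rewrite -exprMn; congr (_ ^+ _); rewrite mulrAC.
move: mdle; rewrite E natrX => mdle; apply: le_trans le_al.
rewrite (_ : s / 3 = m%:R / (3 / h)); last first.
  by rewrite /h; field; rewrite !gt_eqF.
rewrite expr_div_n ler_pdivrMr; last by rewrite exprn_gt0// divr_gt0.
by rewrite mulrC.
Qed.

Lemma grid_approx (m : nat) (h u : R) : 0 < h -> `|u| <= m%:R * h ->
  exists k : 'I_(2 * m).+1, `|u - (k%:R - m%:R) * h| <= h.
Proof.
move=> h0; rewrite ler_norml => /andP[u1 u2].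
pose t := u / h + m%:R.
have uE : u = (t - m%:R) * h by rewrite /t addrK divfK// gt_eqF.
have t0 : 0 <= t by rewrite -(pmulr_lge0 _ h0) /t mulrDl divfK ?gt_eqF//; lra.
have t2 : t <= (2 * m)%:R.
  rewrite -(ler_pM2r h0) /t mulrDl divfK ?gt_eqF// natrM; lra.
have k2 : (Num.truncn t < (2 * m).+1)%N.
  by rewrite ltnS -(ler_nat R) (le_trans _ t2)// truncn_le.
exists (Ordinal k2) => /=.
have := truncnS_gt t; have : (Num.truncn t)%:R <= t by rewrite truncn_le.
rewrite -natr1 uE => H1 H2.
rewrite -mulrBl normrM (gtr0_norm h0) ler_piMl ?(ltW h0)//.
rewrite ler_norml; lra.
Qed.

(** Here [S] lies in a cube of radius [m * h], within distance about [h] of the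
    hyperplane through [c] with normal vector [w].  As [w j = 1] is the largest
    coordinate of [w], a point of the slab is determined up to [d * h] by its
    coordinates other than [j], which are approximated by
    [(2 * m).+1 ^ d.-1] grid points. *)
Lemma content_slab c (w : 'I_d -> R) (j : 'I_d) (m : nat) (h : R) S :
  0 < h -> w j = 1 -> (forall i, `|w i| <= 1) ->
  (forall z, S z -> (forall i, `|z 0 i - c 0 i| <= m%:R * h) /\
                    `|\sum_i w i * (z 0 i - c 0 i)| <= h) ->
  content_le S ((2 * m).+1%:R ^+ d.-1 * (d%:R * h) ^+ d).
Proof.
move=> h0 wj w1 HS.
(* The index [j] carries no choice: its entry is fixed to [ord0], and the
   [j]-th coordinate of the centre is the one that lies on the hyperplane. *)
pose A : pred {ffun 'I_d -> 'I_(2 * m).+1} := fun k => k j == ord0.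
pose off (k : {ffun 'I_d -> 'I_(2 * m).+1}) i : R := ((k i)%:R - m%:R) * h.
pose ctr k : 'rV[R]_d := \row_i (c 0 i +
  if i == j then - \sum_(i' | i' != j) w i' * off k i' else off k i).
have dh : 1 * h <= d%:R * h.
  by rewrite ler_pM2r// ler1n; apply: leq_trans (ltn_ord j).
exists [seq (ctr k, d%:R * h) | k in A]; split.
- by move=> _ /mapP[k _ ->] /=; apply: lt_le_trans dh; rewrite mul1r.
- move=> z /HS[zc zw].
  have /choice[k0 Hk0] : forall i, exists k : 'I_(2 * m).+1,
      `|z 0 i - c 0 i - (k%:R - m%:R) * h| <= h.
    by move=> i; apply: grid_approx.
  pose k := [ffun i => if i == j then ord0 else k0 i].
  have kA : k \in A by rewrite unfold_in /A ffunE eqxx.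
  exists (ctr k, d%:R * h); first by apply: map_f; rewrite mem_enum.
  move=> i /=; rewrite mxE opprD addrA; case: eqVneq => [->|ij]; last first.
    by rewrite /off ffunE (negPf ij) (le_trans (Hk0 _))// -[X in X <= _]mul1r.
  move: zw; rewrite (bigD1 j)//= wj mul1r => zw.
  set u := z 0 j - c 0 j in zw *; clearbody u; rewrite opprK.
  have -> : u + \sum_(i' | i' != j) w i' * off k i' =
    (u + \sum_(i' | i' != j) w i' * (z 0 i' - c 0 i'))
     - \sum_(i' | i' != j) w i' * (z 0 i' - c 0 i' - off k i').
    rewrite -addrA -sumrB; congr (_ + _); apply: eq_bigr => i' _; ring.
  apply: le_trans (ler_normB _ _) _.
  have -> : d%:R * h = h + \sum_(i' < d | i' != j) h.
    by rewrite sumr_const cardC1 card_ord -mulrS prednK// ?mulr_natl//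
       (leq_trans _ (ltn_ord j)).
  apply: lerD => //; apply: le_trans (ler_norm_sum _ _ _) _.
  apply: ler_sum => i' i'j; rewrite normrM -[leRHS]mul1r ler_pM//.
  by rewrite /off ffunE (negPf i'j).
- rewrite big_image/= sumr_const -[leLHS]mulr_natl ler_wpM2r//.
    by rewrite exprn_ge0// mulr_ge0// ltW.
  rewrite -natrX ler_nat.
  pose P i : pred 'I_(2 * m).+1 := if i == j then pred1 ord0 else predT.
  have /subset_leq_card/leq_trans-> // : A \subset family P.
    apply/fintype.subsetP => k kA; apply/familyP => i; rewrite /P.
    by case: eqVneq => [->|//]; rewrite inE.
  rewrite card_family foldrE big_map big_enum/= (bigD1 j)//= /P eqxx card1 mul1n.
  rewrite (eq_bigr (fun=> (2 * m).+1)).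
    by rewrite prod_nat_const cardC1 card_ord.
  by move=> i /negPf->; rewrite card_ord.
Qed.

End Content.

(** * Images of cubes under maps with singular Jacobian *)

Section CriticalImage.
Variables (R : realType) (d : nat).
Implicit Types (a c x y z : 'rV[R]_d) (S : set 'rV[R]_d).

Lemma row_norm_le x (r : R) : 0 <= r ->
  (`|x| <= r) <-> (forall i, `|x 0 i| <= r).
Proof.
move=> r0; rewrite [X in X <= _]/Num.Def.normr/= mx_normrE; split=> [H i|H].
  by apply: le_trans H; apply: (le_bigmax _ (fun ij => `|x ij.1 ij.2|) (0, i)).
by apply: bigmax_le => // -[i j] _ /=; rewrite ord1.
Qed.

(** A vector in the kernel of the transpose, scaled so that its largest
    coordinate is [1]: the normal vector that [content_slab] expects. *)
Lemma singular_kernel (A : 'M[R]_d) : A \notin unitmx ->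
  exists (w : 'I_d -> R) j, [/\ w j = 1, forall i, `|w i| <= 1 &
    forall v : 'rV_d, \sum_i w i * (v *m A) 0 i = 0].
Proof.
rewrite -unitmx_tr unitmxE unitfE negbK => /det0P[v v0 vA].
have [j0 j0P] : exists j, v 0 j != 0.
  apply/existsP; apply: contraNT v0; rewrite negb_exists => /forallP v0.
  by apply/eqP/rowP => i; rewrite mxE; apply/eqP; have := v0 i; rewrite negbK.
pose j := [arg max_(i > j0 in 'I_d) `|v 0 i|]%O.
have jmax i : `|v 0 i| <= `|v 0 j|.
  by rewrite /j; case: arg_maxP => //= k _; apply.
have vj : 0 < `|v 0 j| by apply: lt_le_trans (jmax j0); rewrite normr_gt0.
exists (fun i => v 0 i / v 0 j), j; split.
- by rewrite divff// -normr_gt0.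
- by move=> i; rewrite normrM normfV ler_pdivrMr// mul1r.
move=> u; have : v *m A^T *m u^T = 0 by rewrite vA mul0mx.
rewrite -mulmxA -trmx_mul => /matrixP/(_ 0 0); rewrite !mxE => E.
under eq_bigr do rewrite mulrAC.
rewrite -mulr_suml (_ : \sum_i _ = 0) ?mul0r//.
by rewrite -[RHS]E; apply: eq_bigr => i _; rewrite !mxE.
Qed.

Lemma differentiable_jacobian (f : 'rV[R]_d -> 'rV[R]_d) x (e : R) :
  differentiable f x -> 0 < e ->
  exists2 dl : R, 0 < dl & forall y (r : R), 0 < r -> r < dl -> cube x r y ->
    cube (f x + (y - x) *m 'J f x) (e * r) (f y).
Proof.
move=> fx e0; have /diff_locallyP[_ H] := fx.
have /eqaddoP/(_ e e0) := H.
move=> /nbhs_ballP[dl /= dl0 Hdl]; exists dl => // y r r0 rdl xy.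
have nr : `|y - x| <= r.
  by apply/row_norm_le; [exact: ltW|move=> i; rewrite !mxE].
have := Hdl (y - x).
rewrite -ball_normE/= sub0r normrN => /(_ (le_lt_trans nr rdl)).
rewrite !fctE/= subrK => Hy i.
have : `|f y - (f x + 'd f x (y - x))| <= e * r.
  by apply: le_trans Hy _; rewrite ler_pM2l.
move/row_norm_le => -/(_ (mulr_ge0 (ltW e0) (ltW r0)) i).
by rewrite /jacobian mul_rV_lin1 !mxE.
Qed.

(** The image of a cube of radius [r] containing [x] is within [2 * eta * r]
    of a hyperplane containing [f x + im ('J f x)].  This slab has thickness
    [1 / m] relative to its radius, hence its content is at most
    [K / m * r ^ d] for a constant [K] that depends on [d] and ['J f x] only. *)
Lemma content_image_critical_at (f : 'rV[R]_d -> 'rV[R]_d) x (e : R) :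
  differentiable f x -> 'J f x \notin unitmx -> 0 < e ->
  exists2 dl : R, 0 < dl & forall a (r : R), 0 < r -> r < dl -> cube a r x ->
    content_le (f @` cube a r) (e * r ^+ d).
Proof.
move=> fx /singular_kernel[w [j [wj w1 wJ]]] e0.
have d0 : (0 < d)%N by apply: leq_trans (ltn_ord j).
(* [B] bounds the operator norm of the Jacobian, so that [f y - f x] is at most
   [2 * (B + 1) * r]. *)
pose B := \sum_i \sum_k `|'J f x i k|.
have B0 : 0 <= B by apply: sumr_ge0 => i _; apply: sumr_ge0 => k _.
pose K := 3 ^+ d.-1 * (d%:R * (2 * (B + 1))) ^+ d.
have K0 : 0 < K.
  rewrite /K mulr_gt0 ?exprn_gt0// mulr_gt0 ?ltr0n// mulr_gt0//; lra.
pose m := (Num.truncn (K / e)).+1.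
have m0 : 0 < m%:R :> R by rewrite ltr0n.
have m1 : 1 <= m%:R :> R by rewrite ler1n.
have mK : K / m%:R <= e.
  rewrite ler_pdivrMr// mulrC -ler_pdivrMr//; apply/ltW/truncnS_gt.
have dR : 0 < d%:R :> R by rewrite ltr0n.
have d1 : 1 <= d%:R :> R by rewrite ler1n.
(* With this precision, the [d] terms of the scalar product of [w] and the
   error add up to at most [2 * r / m]. *)
pose eta : R := 1 / (d%:R * m%:R).
have eta0 : 0 < eta by rewrite divr_gt0// mulr_gt0.
have eta1 : eta <= 1.
  by rewrite ler_pdivrMr ?mulr_gt0// mul1r -[X in X <= _]mul1r ler_pM.
have [dl dl0 Hdl] := differentiable_jacobian fx eta0.
exists (dl / 2); first by rewrite divr_gt0.
move=> a r r0 rdl ax.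
pose h := 2 * (B + 1) * r / m%:R.
have h0 : 0 < h.
  by rewrite divr_gt0// mulr_gt0// mulr_gt0//; lra.
have [l [l1 l2 l3]] : content_le (f @` cube a r)
     ((2 * m).+1%:R ^+ d.-1 * (d%:R * h) ^+ d).
  apply: (content_slab (c := f x) h0 wj w1) => _ [y ay <-].
  have xy : cube x (2 * r) y.
    move=> i; move: (ax i) (ay i); rewrite !ler_norml => /andP[? ?] /andP[? ?].
    by apply/andP; split; lra.
  have r2 : 0 < 2 * r by lra.
  have r2dl : 2 * r < dl by lra.
  have := Hdl y _ r2 r2dl xy.
  set v := (y - x) *m 'J f x => Hy.
  have vb i : `|v 0 i| <= 2 * r * B.
    rewrite mxE (le_trans (ler_norm_sum _ _ _))// /B mulr_sumr ler_sum// => k _.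
    rewrite normrM ler_pM//; first by rewrite !mxE; exact: xy.
    by rewrite (bigD1 i)//= lerDl sumr_ge0.
  have eb i : `|f y 0 i - f x 0 i - v 0 i| <= eta * (2 * r).
    by have := Hy i; rewrite mxE opprD addrA.
  split=> [i|].
    rewrite /h mulrC divfK ?gt_eqF// -[X in `|X|](subrK (v 0 i)).
    apply: le_trans (ler_normD _ _) _; have := vb i; have := eb i; nra.
  rewrite (_ : \sum_i _ = \sum_i w i * (f y 0 i - f x 0 i - v 0 i)); last first.
    rewrite -[LHS]subr0 -[X in _ - X](wJ (y - x)) -sumrB.
    by apply: eq_bigr => i _; rewrite -mulrBr.
  apply: (@le_trans _ _ (\sum_(i < d) eta * (2 * r))).
    apply: le_trans (ler_norm_sum _ _ _) _; apply: ler_sum => i _.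
    by rewrite normrM -[leRHS]mul1r ler_pM.
  rewrite sumr_const card_ord -[leLHS]mulr_natl /eta /h.
  rewrite (_ : d%:R * _ = 2 * r / m%:R); last first.
    by field; rewrite !gt_eqF.
  by rewrite ler_pM2r ?invr_gt0//; nra.
exists l; split => //; apply: le_trans l3 _.
apply: (@le_trans _ _ ((3 * m%:R) ^+ d.-1 * (d%:R * h) ^+ d)).
  apply: ler_wpM2r; first by rewrite exprn_ge0// mulr_ge0// ltW.
  by apply: lerXn2r; rewrite ?nnegrE ?mulr_ge0// -natr1 natrM; lra.
rewrite (_ : (3 * _) ^+ _ * _ = K / m%:R * r ^+ d).
  by rewrite ler_pM2r ?exprn_gt0.
rewrite /h /K; move: m0; case: (d) d0 => // d' _ m0.
rewrite /= !exprMn exprVn [in m%:R ^- _]exprS.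
by field; rewrite expf_neq0// gt_eqF.
Qed.

Lemma cube_bisect (a : 'rV[R]_d) (r : R) : 0 <= r ->
  cube a r `<=` \bigcup_(s : {ffun 'I_d -> bool})
    cube (\row_i (a 0 i + (-1) ^+ s i * (r / 2))) (r / 2).
Proof.
move=> r0 x ax; exists [ffun i => x 0 i < a 0 i] => // i.
rewrite mxE ffunE; move: (ax i); rewrite !ler_norml => /andP[? ?].
case: ltP => ?; rewrite ?expr1 ?expr0; apply/andP; split; lra.
Qed.

Lemma cube_bisect_sub (a : 'rV[R]_d) (r : R) (s : {ffun 'I_d -> bool}) :
  cube (\row_i (a 0 i + (-1) ^+ s i * (r / 2))) (r / 2) `<=` cube a r.
Proof.
move=> x H i; move: (H i); rewrite mxE !ler_norml.
case: (s i); rewrite ?expr1 ?expr0 => /andP[? ?]; apply/andP; split; lra.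
Qed.

(** The lower endpoints of the intervals of each coordinate are below all upper
    endpoints; their supremum is a common point. *)
Lemma nested_cubes (a : nat -> 'rV[R]_d) (r : nat -> R) :
  (forall n, 0 < r n) ->
  (forall n, cube (a n.+1) (r n.+1) `<=` cube (a n) (r n)) ->
  exists x, forall n, cube (a n) (r n) x.
Proof.
move=> r0 sub.
have subn n k : cube (a (n + k)%N) (r (n + k)%N) `<=` cube (a n) (r n).
  elim: k => [|k IH]; first by rewrite addn0.
  by rewrite addnS; apply: subset_trans IH; exact: sub.
have meet n m : exists x, cube (a n) (r n) x /\ cube (a m) (r m) x.
  exists (a (n + m)%N).
  have ctr : cube (a (n + m)%N) (r (n + m)%N) (a (n + m)%N).
    by move=> i; rewrite subrr normr0 ltW.
  by split; [exact: subn ctr|move: ctr; rewrite addnC; exact: subn].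
have lohi n m i : a n 0 i - r n <= a m 0 i + r m.
  have [x [/(_ i) + /(_ i)]] := meet n m.
  by rewrite !ler_norml => /andP[? ?] /andP[? ?]; lra.
pose lo i := [set a n 0 i - r n | n in [set: nat]].
exists (\row_i sup (lo i)) => n i; rewrite mxE.
have ne : lo i !=set0 by exists (a 0%N 0 i - r 0%N); exists 0%N.
have ub m : ubound (lo i) (a m 0 i + r m) by move=> _ [k _ <-].
rewrite ler_norml; apply/andP; split.
  rewrite lerBrDl; apply: ub_le_sup; last by exists n.
  by exists (a n 0 i + r n).
by rewrite lerBlDl; apply: ge_sup.
Qed.

(** If the bound fails for a cube, it fails for one of the [2 ^ d] cubes of its
    bisection, as the right-hand sides for these add up to [e * r ^ d].  The
    cubes so obtained shrink to a point where the bound contradicts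
    [content_image_critical_at]. *)
Lemma content_image_critical (f : 'rV[R]_d -> 'rV[R]_d) a (r e : R) :
  (forall x, cube a r x -> differentiable f x /\ 'J f x \notin unitmx) ->
  0 < r -> 0 < e -> content_le (f @` cube a r) (e * r ^+ d).
Proof.
move=> crit r0 e0; apply: contrapT => bad.
pose Bad (p : 'rV[R]_d * R) := ~ content_le (f @` cube p.1 p.2) (e * p.2 ^+ d).
have /choice[step Hstep] : forall p, exists c, 0 < p.2 -> Bad p ->
    Bad (c, p.2 / 2) /\ cube c (p.2 / 2) `<=` cube p.1 p.2.
  move=> [c s]; apply: contrapT => /forallNP H.
  have [s0 badc] : 0 < s /\ Bad (c, s).
    by have /not_implyP[? /not_implyP[? _]] := H 0.
  apply: badc.
  have -> : e * s ^+ d = \sum_(k : {ffun 'I_d -> bool}) (e * (s / 2) ^+ d).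
    rewrite sumr_const card_ffun card_bool card_ord -[RHS]mulr_natr natrX.
    by rewrite -mulrA -exprMn divfK.
  apply: (content_le_bigcup (F := fun k : {ffun 'I_d -> bool} =>
    f @` cube (\row_i (c 0 i + (-1) ^+ k i * (s / 2))) (s / 2))).
    by move=> _ [x /(cube_bisect (ltW s0))[k _ kx] <-]; exists k => //; exists x.
  move=> k; apply: contrapT => badk.
  apply: (H (\row_i (c 0 i + (-1) ^+ k i * (s / 2)))) => _ _; split => //.
  exact: cube_bisect_sub.
pose p n := iter n (fun p => (step p, p.2 / 2)) (a, r).
have p2 n : (p n).2 = r / 2 ^+ n.
  by elim: n => [|n IH]; rewrite ?expr0 ?divr1//= IH exprSr invfM mulrA.
have p0 n : 0 < (p n).2 by rewrite p2 divr_gt0// exprn_gt0.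
have pbad n : Bad (p n).
  by elim: n => [//|n IH]; have [] := Hstep _ (p0 n) IH.
have psub n : cube (p n.+1).1 (p n.+1).2 `<=` cube (p n).1 (p n).2.
  by have [] := Hstep _ (p0 n) (pbad n).
have [x xp] := nested_cubes p0 psub.
have [fx Jx] := crit x (xp 0%N).
have [dl dl0 Hdl] := content_image_critical_at fx Jx e0.
pose n := (Num.truncn (r / dl)).+1.
apply: (pbad n); apply: Hdl => //.
rewrite p2 ltr_pdivrMr ?exprn_gt0// mulrC -ltr_pdivrMr//.
apply: lt_le_trans (truncnS_gt _) _.
by rewrite -natrX ler_nat ltnW// ltn_expl.
Qed.

Lemma critical_image_no_cube (f : 'rV[R]_d -> 'rV[R]_d) a c (r s : R) :
  (forall x, cube a r x -> differentiable f x /\ 'J f x \notin unitmx) ->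
  0 < r -> 0 < s -> ~ (cube c s `<=` f @` cube a r).
Proof.
move=> crit r0 s0 sub.
have sd : 0 < (s / 3) ^+ d by rewrite exprn_gt0// divr_gt0.
have rd : 0 < r ^+ d by rewrite exprn_gt0.
pose e := (s / 3) ^+ d / 2 / r ^+ d.
have e0 : 0 < e by rewrite divr_gt0// divr_gt0.
have [l [l1 l2 l3]] := content_image_critical crit r0 e0.
have /(content_cube s0) : content_le (cube c s) (e * r ^+ d).
  by exists l; split => // x /sub; exact: l2.
by rewrite /e divfK ?gt_eqF//; lra.
Qed.

End CriticalImage.

(** * Tensors under linear maps *)

Section Pushforward.
Variables (R : realType) (d : nat).

(** The map induced by the linear map [v |-> v *m T] on contravariant tensors. *)
Definition push (T : 'M[R]_d) (k : nat) (S : tensor R d k) : tensor R d k :=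
  fun t => \sum_(u : {ffun 'I_k -> 'I_d}) S u * \prod_i T (u i) (t i).

(** In the term of the permutation [s], the factors of the product of the
    entries of [T] are reordered by [s]; then a multi-index of length [k + l]
    is a pair of multi-indices of lengths [k] and [l]. *)
Lemma wedge_push (T : 'M[R]_d) (k l : nat) (A : tensor R d k)
    (B : tensor R d l) :
  wedge (push T A) (push T B) = push T (wedge A B).
Proof.
apply/funext => t; rewrite /push /wedge.
under [RHS]eq_bigr do rewrite -mulrA mulr_suml mulr_sumr.
rewrite mulr_sumr exchange_big/=; apply: eq_bigr => s _.
rewrite -mulr_sumr; congr (_ * _).
under [RHS]eq_bigr do rewrite -!mulrA.
rewrite -mulr_sumr -mulrA; congr (_ * _).
pose t' i := t (s i).
transitivity (\sum_(w : {ffun 'I_(k + l) -> 'I_d})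
    A (fun i => w (lshift l i)) *
   (B (fun j => w (rshift k j)) * \prod_i T (w i) (t' i))); last first.
  pose g (w : {ffun 'I_(k + l) -> 'I_d}) := [ffun i => w (s i)].
  rewrite (reindex g)/=; last first.
    exists (fun w => [ffun i => w ((s^-1)%g i)]) => w _; apply/ffunP => i;
      by rewrite !ffunE ?permKV ?permK.
  apply: eq_bigr => w _; congr (A _ * (B _ * _)).
  - by apply/funext => i; rewrite ffunE.
  - by apply/funext => i; rewrite ffunE.
  - rewrite [RHS](reindex_inj (@perm_inj _ s)).
    by apply: eq_bigr => i _; rewrite ffunE.
pose glue (p : {ffun 'I_k -> 'I_d} * {ffun 'I_l -> 'I_d}) :
    {ffun 'I_(k + l) -> 'I_d} :=
  [ffun i : 'I_(k + l) =>
     match fintype.split i with inl i1 => p.1 i1 | inr i2 => p.2 i2 end].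
have gl p (i : 'I_k) : glue p (lshift l i) = p.1 i.
  by rewrite ffunE (unsplitK (inl _ i)).
have gr p (i : 'I_l) : glue p (rshift k i) = p.2 i.
  by rewrite ffunE (unsplitK (inr _ i)).
rewrite (reindex glue)/=; last first.
  exists (fun w => ([ffun i => w (lshift l i)], [ffun j => w (rshift k j)])).
    move=> [u v] _; congr pair; apply/ffunP => i; by rewrite ffunE ?gl ?gr.
  by move=> w _; apply/ffunP => i; rewrite ffunE; case: split_ordP => j ->;
    rewrite ffunE.
rewrite big_distrlr pair_big/=; apply: eq_bigr => -[u v] _ /=.
rewrite big_split_ord/= mulrACA !mulrA; congr (_ * _ * _ * _).
- by congr A; apply/funext => i; rewrite gl.
- by congr B; apply/funext => i; rewrite gr.
- by apply: eq_bigr => i _; rewrite gl.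
- by apply: eq_bigr => i _; rewrite gr.
Qed.

Lemma wedge_pow_push (T : 'M[R]_d) (A : tensor R d 2) n :
  wedge_pow (push T A) n = push T (wedge_pow A n).
Proof.
elim: n => [|n IH] /=; last by rewrite IH wedge_push.
apply/funext => t; rewrite /push (eq_bigr (fun=> 1)).
  by rewrite sumr_const card_ffun !card_ord mul0n expn0.
by move=> u _; rewrite big1 ?mulr1// => -[].
Qed.

Lemma vector_push (T : 'M[R]_d) (X : 'rV[R]_d) :
  tensor_of_vector (X *m T) = push T (tensor_of_vector X).
Proof.
apply/funext => t; rewrite /push /tensor_of_vector mxE.
rewrite [RHS](reindex (fun i : 'I_d => [ffun _ : 'I_1 => i]))/=.
  by apply: eq_bigr => i _; rewrite ffunE big_ord1 ffunE.
exists (fun u : {ffun 'I_1 -> 'I_d} => u ord0) => u _; first by rewrite ffunE.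
by apply/ffunP => i; rewrite ffunE (ord1 i).
Qed.

Lemma bivector_push (T P : 'M[R]_d) :
  tensor_of_bivector (T^T *m P *m T) = push T (tensor_of_bivector P).
Proof.
apply/funext => t; rewrite /push /tensor_of_bivector mxE.
under eq_bigr do rewrite mxE mulr_suml.
rewrite exchange_big pair_big/=.
pose mk (p : 'I_d * 'I_d) := [ffun i : 'I_2 => if i == ord0 then p.1 else p.2].
rewrite [RHS](reindex mk)/=.
  apply: eq_bigr => -[i j] _.
  rewrite !ffunE /= big_ord_recl big_ord1 !mxE !ffunE/=.
  rewrite (_ : lift ord0 ord0 = ord_max :> 'I_2); last exact: val_inj.
  by rewrite [T i _ * _]mulrC mulrA.
exists (fun u : {ffun 'I_2 -> 'I_d} => (u ord0, u ord_max)).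
  by move=> [i j] _; rewrite !ffunE.
move=> u _; apply/ffunP => i; rewrite ffunE; case: eqVneq => [->//|i0] /=.
by congr (u _); apply: val_inj; case: i i0 => -[|[|]].
Qed.

(** [E /\ pi^n] at a point; [contact_tensor] is this expression for the values
    of the fields in a chart. *)
Definition contact_form (E : 'rV[R]_d) (P : 'M[R]_d) n : tensor R d (1 + n * 2) :=
  wedge (tensor_of_vector E) (wedge_pow (tensor_of_bivector P) n).

Arguments contact_form : clear implicits.

(** By naturality of the wedge product, the tensor of the hypothesis is the image
    of that of the conclusion under a linear map, which sends zero to zero. *)
Lemma contact_form_push_neq0 (T : 'M[R]_d) E P n :
  (exists t, contact_form (E *m T) (T^T *m P *m T) n t != 0) ->
  exists t, contact_form E P n t != 0.
Proof.
apply: contraPP => /forallNP H [t]; apply/negP; rewrite negbK.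
rewrite /contact_form vector_push bivector_push wedge_pow_push wedge_push.
rewrite /push big1// => u _.
have /negP := H u; rewrite negbK => /eqP.
by rewrite /contact_form => ->; rewrite mul0r.
Qed.

End Pushforward.
Arguments contact_form {R d} E P n.

Section TensorContinuity.
Variables (R : realType) (d : nat) (X : topologicalType) (p : X).

Definition tensor_cont k (S : X -> tensor R d k) :=
  forall t, S q t @[q --> p] --> S p t.

Lemma wedge_cont k l (A : X -> tensor R d k) (B : X -> tensor R d l) :
  tensor_cont A -> tensor_cont B -> tensor_cont (fun q => wedge (A q) (B q)).
Proof.
move=> Ac Bc t; rewrite /wedge; apply: cvgM; first exact: cvg_cst.
apply: cvg_big => [|s _]; first exact: add_continuous.
apply: cvgM (Bc _).
by apply: cvgM (Ac _); exact: cvg_cst.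
Qed.

Lemma wedge_pow_cont (A : X -> tensor R d 2) n :
  tensor_cont A -> tensor_cont (fun q => wedge_pow (A q) n).
Proof.
move=> Ac; elim: n => [t|n IH] /=; first exact: cvg_cst.
exact: wedge_cont.
Qed.

Lemma contact_form_cont (E : X -> 'rV[R]_d) (P : X -> 'M[R]_d) n :
  (forall j, E q 0 j @[q --> p] --> E p 0 j) ->
  (forall i j, P q i j @[q --> p] --> P p i j) ->
  tensor_cont (fun q => contact_form (E q) (P q) n).
Proof.
move=> Ec Pc; apply: wedge_cont => [t|]; first exact: Ec.
by apply: wedge_pow_cont => t; exact: Pc.
Qed.

End TensorContinuity.

(** * Sard's theorem in equal dimensions *)

Section CubeTopology.
Variables (R : realType) (d : nat).
Implicit Types (a c x y : 'rV[R]_d) (f : 'rV[R]_d -> 'rV[R]_d).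

Lemma nbhs_cubeP x (A : set 'rV[R]_d) :
  nbhs x A <-> exists2 r : R, 0 < r & cube x r `<=` A.
Proof.
split=> [/nbhs_ballP[e /= e0 eA]|[r r0 rA]].
  exists (e / 2); first by rewrite divr_gt0.
  move=> y xy; apply: eA; rewrite -ball_normE/= distrC.
  apply: (@le_lt_trans _ _ (e / 2)); last lra.
  by apply/row_norm_le; [rewrite divr_ge0// ltW|move=> i; rewrite !mxE].
apply/nbhs_ballP; exists r => // y; rewrite -ball_normE/= distrC => /ltW.
move=> /(row_norm_le _ (ltW r0)) xy; apply: rA => i.
by have := xy i; rewrite !mxE.
Qed.

Lemma compact_cube a (r : R) : compact (cube a r).
Proof.
have := @rV_compact R d (fun i => `[a 0 i - r, a 0 i + r]%classic)
  (fun i => @segment_compact _ _ _).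
rewrite (_ : mkset _ = cube a r)//; apply/seteqP; split=> x H i.
  by have := H i; rewrite /= in_itv/= ler_distl.
by have := H i; rewrite /= in_itv/= ler_distl.
Qed.

Lemma closed_image_cube f a (r : R) :
  (forall x, cube a r x -> differentiable f x) -> closed (f @` cube a r).
Proof.
move=> fd; apply: compact_closed; first exact: norm_hausdorff.
apply: continuous_compact; last exact: compact_cube.
apply: continuous_in_subspaceT => x; rewrite inE => /fd.
exact: differentiable_continuous.
Qed.

Lemma dense_setC_critical_image f a (r : R) :
  (forall x, cube a r x -> differentiable f x /\ 'J f x \notin unitmx) ->
  0 < r -> dense (~` (f @` cube a r)).
Proof.
move=> crit r0 O [y Oy] oO; apply: contrapT => H.
have [s s0 sO] : exists2 s : R, 0 < s & cube y s `<=` O.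
  by apply/nbhs_cubeP; move: oO; rewrite openE; apply.
apply: (critical_image_no_cube (c := y) crit r0 s0) => z /sO Oz.
by apply: contrapT => nz; apply: H; exists z.
Qed.

Lemma differentiable_row f x :
  (forall j, differentiable (fun y => f y 0 j) x) -> differentiable f x.
Proof.
move=> H; rewrite (_ : f = \sum_(j < d) (fun y => f y 0 j *: delta_mx 0 j)).
  by apply: differentiable_sum => j; exact: differentiableZl.
by apply/funext => y; rewrite fct_sumE -row_sum_delta.
Qed.

End CubeTopology.

(** Joins the known completeness and norm of spaces of matrices, so that
    Baire's theorem applies to row vectors. *)
HB.instance Definition _ (R : realType) (m n : nat) :=
  Complete.on 'M[R]_(m, n).

Section Charts.
Variables (R : realType) (r : regularity) (d : nat).

Lemma chart_param_nbhs (T : topologicalType) (c : chart R T d) (W : set T) p :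
  open W -> W p -> dom c p ->
  nbhs (c p) [set y | exists2 q, (dom c `&` W) q & c q = y /\ param c y = q].
Proof.
move=> oW Wp cp.
have icp : (c @` dom c) (c p) by exists p.
have ic : nbhs (c p) (c @` dom c).
  by have := @open_img _ _ _ c; rewrite openE; apply.
have pW : nbhs (c p) (param c @^-1` W).
  apply: (@param_cont _ _ _ c (c p)); first by rewrite inE.
  by rewrite coordK ?inE//; move: oW; rewrite openE; apply.
near=> y.
have [q cq qy] : (c @` dom c) y by near: y.
have pq : param c y = q by rewrite -qy coordK// inE.
by exists q => //; split=> //; rewrite -pq; near: y.
Unshelve. all: by end_near. Qed.

Lemma chart_component_cont (T : topologicalType) (c : chart R T d)
    (g : T -> R) p :
  dom c p -> differentiable (fun y => g (param c y)) (c p) ->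
  g q @[q --> p] --> g p.
Proof.
move=> cp /differentiable_continuous gd.
have pc : dom c p -> param c (c p) = p by move=> ?; rewrite coordK ?inE.
have : (g \o param c) (c q) @[q --> p] --> (g \o param c) (c p).
  apply: (@cvg_comp _ _ _ c (g \o param c) _ (nbhs (c p))); last exact: gd.
  by apply: coord_cont; rewrite inE.
rewrite /= pc//; apply: cvg_trans; apply: near_eq_cvg.
have : nbhs p (dom c) by have := open_dom c; rewrite openE; apply.
by apply: filterS => q cq /=; rewrite coordK ?inE.
Qed.

(** Sard's theorem in equal dimensions, in the form: a nonempty open set in the
    range of [phi] contains the image of a point where the tangent map of [phi]
    is invertible.  Everything is read in one chart [c'] around a point of
    [V]. *)
Lemma regular_point_exists (N M : manifold R r d) (phi : N -> M) (V : set M) :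
  @second_countable N -> regular_map phi -> open V -> V !=set0 ->
  (forall q, V q -> exists p, phi p = q) ->
  exists p c c', [/\ atlas c /\ dom c p, atlas c' /\ dom c' (phi p), V (phi p) &
    'J (c' \o phi \o param c) (c p) \in unitmx].
Proof.
move=> [B Bcount [Bopen Bbasis]] [phic phireg] oV [q0 Vq0] surj.
apply: contrapT => none.
have [c' ac' c'q0] := @atlas_cover _ _ _ M q0.
pose W := phi @^-1` (V `&` dom c').
have oW : open W.
  apply: open_comp; first by move=> x _; exact: phic.
  by apply: openI => //; exact: open_dom.
pose thin (G : set 'rV[R]_d) := closed G /\ dense (~` G).
pose good (b : set N) := exists2 G, thin G & (c' \o phi) @` b `<=` G.
have good_nbhd p : W p -> exists b, [/\ B b, b p & good b].
  move=> Wp; have [c ac cp] := @atlas_cover _ _ _ N p.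
  have /nbhs_cubeP[s s0 sub] := chart_param_nbhs oW Wp cp.
  pose F := c' \o phi \o param c.
  have crit y : cube (c p) s y -> differentiable F y /\ 'J F y \notin unitmx.
    move=> /sub[q [cq Wq] [qy yq]]; split.
      apply: differentiable_row => j.
      have [/(_ [::] y) + _] := phireg c c' ac ac' j; apply.
      by exists q => //; split => //; case: Wq.
    apply/negP => JF; apply: none; exists q, c, c'.
    by case: Wq => Vq c'q; rewrite qy.
  have np : nbhs p (dom c `&` c @^-1` cube (c p) s).
    apply: filterI; first by have := open_dom c; rewrite openE; apply.
    apply: (@coord_cont _ _ _ c p); first by rewrite inE.
    by apply/nbhs_cubeP; exists s.
  have [b [Bb bp] bsub] := Bbasis p _ np.
  exists b; split => //; exists (F @` cube (c p) s).
    split; last exact: dense_setC_critical_image.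
    by apply: closed_image_cube => y /crit[].
  move=> _ [q bq <-]; have [cq sq] := bsub _ bq.
  by exists (c q) => //; rewrite /F/= coordK ?inE.
have /countable_injP[code code_inj] := Bcount.
(* [G n] is the thin set of the basic set of code [n], if there is a good one;
   [set0] is a thin default value. *)
have /choice[G HG] : forall n : nat, exists G, thin G /\
    forall b, B b -> good b -> code b = n -> (c' \o phi) @` b `<=` G.
  move=> n.
  have [[b [Bb [G tG bG] bn]]|nb] :=
    pselect (exists b, [/\ B b, good b & code b = n]).
    exists G; split => // b' Bb' _ b'n.
    by rewrite (code_inj b' b) ?inE// b'n.
  exists set0; split.
    by split; [exact: closed0|rewrite setC0 => O [y Oy] _; exists y].
  by move=> b Bb gb bn; case: nb; exists b.
have dG : dense (\bigcap_n (~` G n)).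
  apply: Baire => n; have [[cG dG] _] := HG n.
  by split => //; exact: closed_openC.
have nq0 := chart_param_nbhs oV Vq0 c'q0.
pose O := interior
  [set y | exists2 q, (dom c' `&` V) q & c' q = y /\ param c' y = q].
have [y [Oy Gy]] : O `&` \bigcap_n (~` G n) !=set0.
  apply: dG; last exact: open_interior.
  by exists (c' q0).
have [q [c'q Vq] [qy _]] := interior_subset Oy.
have [p pq] := surj q Vq.
have [b [Bb bp gb]] : exists b, [/\ B b, b p & good b].
  by apply: good_nbhd; rewrite /W/= pq.
have [_ Gb] := HG (code b).
by apply: (Gy (code b) I); apply: (Gb b Bb gb erefl); exists p => //=; rewrite pq.
Qed.

End Charts.

(** * The contact locus of a Jacobi structure *)

Section Contact.
Variables (R : realType) (r : regularity) (d : nat).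

Arguments contact_tensor {R r d M} J n c p : rename.

Definition contact_at (M : manifold R r d) (J : jacobi_structure M) n p :=
  exists c t, [/\ atlas c, dom c p & contact_tensor J n c p t != 0].

(** If [c0] is the chart that witnesses [contact_at], the components in [c0] are
    the image of those in [c] under the Jacobian of the change of
    coordinates. *)
Lemma contact_at_chart (M : manifold R r d) (J : jacobi_structure M) n p c :
  contact_at J n p -> atlas c -> dom c p ->
  exists t, contact_tensor J n c p t != 0.
Proof.
move=> [c0 [t [ac0 c0p Ht]]] ac cp.
apply: (@contact_form_push_neq0 _ _ ('J (c0 \o param c) (c p))).
by exists t; rewrite -vf_change// -bf_change.
Qed.

Lemma open_contact_at (M : manifold R r d) (J : jacobi_structure M) n :
  open [set p | contact_at J n p].
Proof.
rewrite openE => p [c [t [ac cp Ht]]].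
have Tc : contact_tensor J n c q t @[q --> p] --> contact_tensor J n c p t.
  have dcp : (c @` dom c) (c p) by exists p.
  apply: contact_form_cont => [j|i j]; apply: (chart_component_cont cp).
    by have [/(_ [::] (c p) dcp)] := vf_regular (jE J) ac j.
  by have [/(_ [::] (c p) dcp)] := bf_regular (jpi J) ac i j.
have nz : \forall q \near p, contact_tensor J n c q t != 0.
  exact: cvgr_neq0 Tc Ht.
have nd : nbhs p (dom c) by have := open_dom c; rewrite openE; apply.
by apply: filterS (filterI nd nz) => q [cq qt]; exists c, t.
Qed.

(** The inverse of the tangent map sends the structure of [M] at [phi p] to that
    of [N] at [p]. *)
Lemma contact_at_regular_value (N M : manifold R r d) (JN : jacobi_structure N)
    (JM : jacobi_structure M) (phi : N -> M) n p c c' :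
  jacobi_morphism JN JM phi -> atlas c -> dom c p -> atlas c' ->
  dom c' (phi p) -> 'J (c' \o phi \o param c) (c p) \in unitmx ->
  contact_at JN n p -> contact_at JM n (phi p).
Proof.
move=> [_ mor] ac cp ac' c'p; set T := 'J _ _ => Tu ctN.
have [piE EE] := mor c c' p ac ac' cp c'p; rewrite -/T in piE EE.
have [t Ht] := contact_at_chart ctN ac cp.
have [t' Ht'] : exists t,
    contact_form (jE JM c' (phi p)) (jpi JM c' (phi p)) n t != 0.
  apply: (@contact_form_push_neq0 _ _ (invmx T)); exists t.
  rewrite -piE -EE -!mulmxA mulmxV// mulmx1 !mulmxA -trmx_mul mulmxV// trmx1.
  by rewrite mul1mx mulmx1.
by exists c', t'.
Qed.

Lemma contact_on_dense_open (M : manifold R r d) (J : jacobi_structure M)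
    (S : contact_resolution J) : separable_resolution S ->
  exists U : set M, [/\ open U, dense U & contact_on J U].
Proof.
move=> sep; have [n dn ctS] := res_contact S.
exists [set q | contact_at J n q]; split; first exact: open_contact_at.
- move=> O O0 oO.
  have [p [c [c' [[ac cp] [ac' c'p] Op Tu]]]] := regular_point_exists sep
    (res_morphism S).1 oO O0 (fun q _ => res_surj S q).
  exists (res_map p); split => //.
  apply: (contact_at_regular_value (res_morphism S) ac cp ac' c'p Tu).
  by have [t Ht] := ctS c p ac cp I; exists c, t.
- exists n => // c q ac cq ctq; exact: contact_at_chart ctq ac cq.
Qed.

End Contact.

Theorem corollary4p1 (R : realType) (r : regularity) (d : nat)
    (M : manifold R r d) (J : jacobi_structure M) :
  @second_countable M ->
  connected [set: M] ->
  (exists S : contact_resolution J, separable_resolution S) ->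
  (exists U : set M, [/\ open U, dense U & contact_on J U]) /\ odd d.
Proof.
move=> _ _ [S sep]; split; first exact: contact_on_dense_open sep.
by have [n dn _] := res_contact S; rewrite dn addn1 /= oddM.
Qed.
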